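(* Over $\Sigma=\{a,b,x,y,z\}$ let $$L^\star=\{a^nxb^n:n\ge0\}\cup\{a^nyb^n:n\ge0\}\cup\{za^nxb^n:n\ge0\}.$$ For all integers $k,\ell\ge0$, the language $L^\star$ is not $k,\ell$-substitutable.
   Context: A language $L\subseteq\Sigma^*$ is $k,\ell$-substitutable if, for every $u\in\Sigma^k$, $v\in\Sigma^\ell$ and all $y_1,y_2\in\Sigma^*$ with $uy_1v$ and $uy_2v$ nonempty: whenever there is an outer context $(p,s)\in\Sigma^*\times\Sigma^*$ with $p\,uy_1v\,s\in L$ and $p\,uy_2v\,s\in L$, then for every $(p',s')\in\Sigma^*\times\Sigma^*$, $p'\,uy_1v\,s'\in L$ if and only if $p'\,uy_2v\,s'\in L$. *)

(* Defs.v *)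
From mathcomp Require Import all_boot.

Set Implicit Arguments.
Unset Strict Implicit.
Unset Printing Implicit Defensive.

Definition language (Sigma : Type) := seq Sigma -> Prop.

Definition substitutable (Sigma : Type) (k l : nat) (L : language Sigma) : Prop :=
  forall (u : k.-tuple Sigma) (v : l.-tuple Sigma) (y1 y2 : seq Sigma),
    u ++ y1 ++ v <> [::] ->
    u ++ y2 ++ v <> [::] ->
    (exists p s : seq Sigma,
        L (p ++ (u ++ y1 ++ v) ++ s) /\ L (p ++ (u ++ y2 ++ v) ++ s)) ->
    forall p' s' : seq Sigma,
      L (p' ++ (u ++ y1 ++ v) ++ s') <-> L (p' ++ (u ++ y2 ++ v) ++ s').

Inductive letter : Type := La | Lb | Lx | Ly | Lz.

Definition Lstar : language letter := fun w =>
  [\/ exists n : nat, w = nseq n La ++ [:: Lx] ++ nseq n Lb,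
      exists n : nat, w = nseq n La ++ [:: Ly] ++ nseq n Lb
    | exists n : nat, w = [:: Lz] ++ nseq n La ++ [:: Lx] ++ nseq n Lb].

(* Main.v *)
(* With N = k + l, the words a^N x b^N and a^N y b^N share the empty context,
   but prefixing z keeps only the first one in the language. *)
Require Import Defs.
From mathcomp Require Import all_boot.

(** With [u] = a^k and [v] = b^l, the middle word can supply the missing letters, so both factors
    become balanced words a^(k+l) c b^(k+l), c = x or y. The empty context accepts both; left
    context z accepts only x. *)

Lemma Lstar_zy_free (w : seq letter) :
  has (fun c => if c is Ly then true else false) w -> ~ Lstar (Lz :: w).
Proof.
(* Splitting [n] exposes the first letter, which is z only in the third family; that family has no
   y. *)
move=> hasy [[[|n]]|[[|n]]|[n [ew]]] //.
by move: hasy; rewrite ew has_cat /= !has_nseq !andbF.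
Qed.

Theorem proposition15p20 (k l : nat) : ~ substitutable k l Lstar.
Proof.
(* The exponents are swapped: k a's need l more, l b's need k more. *)
pose mid c := nseq l La ++ [:: c] ++ nseq k Lb.
have midE c : nseq_tuple k La ++ mid c ++ nseq_tuple l Lb =
    nseq (k + l) La ++ [:: c] ++ nseq (k + l) Lb.
  by rewrite /mid /= !nseqD -!catA.
have mid_neq0 c : nseq_tuple k La ++ mid c ++ nseq_tuple l Lb <> [::].
  (* Even when [k + l] is 0, the letter [c] remains. *)
  by rewrite midE; case: (k + l).
move=> /(_ (nseq_tuple k La) (nseq_tuple l Lb) (mid Lx) (mid Ly)
          (mid_neq0 Lx) (mid_neq0 Ly)).
rewrite !midE => subst_xy.
have [|zx_zy _] := subst_xy _ [:: Lz] [::].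
  exists [::], [::]; rewrite !cats0.
  by split; [apply: Or31 | apply: Or32]; exists (k + l).
apply: Lstar_zy_free (zx_zy _); first by rewrite !has_cat /= orbT.
by rewrite cats0; apply: Or33; exists (k + l).
Qed.
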